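(* There is an absolute constant $C>0$ such that the following holds. Let $r\ge 2$ and $k\ge 1$ be integers, and let $0<\delta\le 1$ be a real number such that $n=(1+\delta)r^k$ is an integer. Then in every $k$-edge-coloring of $K_n$ there is a monochromatic subgraph $H$ with $\chi(H)\ge r+1$ and \[\operatorname{diam}(H)\le C\,k^{3/2}\,\delta^{-1/2}\log r .\]
   Context: $K_n$ denotes the complete graph on $n$ vertices. A $k$-edge-coloring of a graph is an arbitrary assignment of one of $k$ colors to each edge; a subgraph (not necessarily induced or spanning) is monochromatic if all of its edges have the same color. $\chi(H)$ denotes the chromatic number of a graph $H$. The diameter $\operatorname{diam}(H)$ is the maximum over pairs $u,v\in V(H)$ of the length (number of edges) of a shortest path in $H$ between $u$ and $v$ (infinite if $H$ is disconnected). *)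

(* Defs.v *)
From mathcomp Require Import all_boot all_order all_algebra.
From mathcomp Require Import all_classical all_reals all_analysis.

Set Implicit Arguments.
Unset Strict Implicit.
Unset Printing Implicit Defensive.

Import Order.TTheory GRing.Theory Num.Theory.

Local Open Scope ring_scope.

(* Simple graphs whose vertex set is a subset of an ambient finite type, so
   that a subgraph of a graph on T is again a graph on T. Edges are unordered
   pairs of distinct vertices. *)
Record sgraph (T : finType) := SGraph {
  verts : {set T};
  edges : {set {set T}};
  edgesP : edges \subset [set e in powerset verts | #|e| == 2%N]%SET
}.

Definition subgraph (T : finType) (H G : sgraph T) : bool :=
  (verts H \subset verts G) && (edges H \subset edges G).

Definition complete_graph (n : nat) : sgraph 'I_n :=
  @SGraph 'I_n [set: 'I_n]%SET
    [set e in powerset [set: 'I_n] | #|e| == 2%N]%SET (subxx _).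

(* An edge coloring is a total function c on sets of vertices; only its values
   on edges matter. *)
Definition monochromatic (T : finType) (k : nat) (c : {set T} -> 'I_k)
    (H : sgraph T) : Prop :=
  exists i : 'I_k, forall e, e \in edges H -> c e = i.

Definition adj (T : finType) (H : sgraph T) : rel T :=
  fun x y => [set x; y]%SET \in edges H.

Definition colorable (T : finType) (H : sgraph T) (m : nat) : bool :=
  [exists f : {ffun {x : T | x \in verts H} -> 'I_m},
     [forall u, [forall v, adj H (val u) (val v) ==> (f u != f v)]]].

Lemma adj_irrefl (T : finType) (H : sgraph T) : irreflexive (adj H).
Proof.
move=> x; apply/negbTE/negP => /(fintype.subsetP (edgesP H)).
by rewrite inE finset.setUid cards1 andbF.
Qed.

Lemma ex_colorable (T : finType) (H : sgraph T) : exists m, colorable H m.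
Proof.
exists #|{: {x : T | x \in verts H}}|; apply/existsP.
exists [ffun u => enum_rank u]; apply/forallP => u; apply/forallP => v.
apply/implyP; rewrite !ffunE; apply: contraTneq => /enum_rank_inj ->.
by rewrite adj_irrefl.
Qed.

Definition chromatic_number (T : finType) (H : sgraph T) : nat :=
  ex_minn (ex_colorable H).

Definition is_path (T : finType) (H : sgraph T) (u v : T) (p : seq T) : Prop :=
  [/\ path (adj H) u p, uniq (u :: p) & last u p = v].

(* The sequence p omits the starting vertex u, so size p counts edges. The
   infimum of the empty set is +oo. *)
Definition dist (R : realType) (T : finType) (H : sgraph T) (u v : T) :
    \bar R :=
  ereal_inf [set (size p)%:R%:E | p in [set p | is_path H u v p]]%classic.

Definition diam (R : realType) (T : finType) (H : sgraph T) : \bar R :=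
  \big[maxe/0%:E]_(u in verts H) \big[maxe/0%:E]_(v in verts H) dist R H u v.

(* Main.v *)
(** Suppose that in every color all balls of radius m are r-colorable.  Then the
   complement of each color class G_i has Lovasz theta number at most
   t = r (1 + O(lam^2)), where lam = O(ln n / m): there are vectors x_u of
   squared norm t - 1 with inner product -1 across every edge of G_i.  The
   entrywise product over i of the matrices <x_u, x_v> + 1 dominates the
   all-ones matrix (Schur), but equals t^k times the identity since every pair
   is an edge of some G_i; hence n <= t^k, which is false for
   lam^2 ~ delta / k.

   If the vectors do not exist, semidefinite duality gives a positive
   semidefinite Y supported on the diagonal and the edges of G_i with
   sum Y > t tr Y.  After rescaling its rows and columns, every row sum is at
   least t times the diagonal entry.  Center a weight g, decaying like
   (1 - lam)^distance, at the vertex with the largest diagonal entry.  Averaging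
   the row sums with weights g^2 compares t * sum g^2 Y_uu with the quadratic
   form of Y at g, which is at most r * sum g^2 Y_uu because the support of g is
   r-colorable; the error involves squared increments of g only, hence lam^2. *)

Require Import Defs.
From mathcomp Require Import all_boot all_order all_algebra.
From mathcomp Require Import all_classical all_reals all_analysis.
From mathcomp Require Import ring lra.

Set Implicit Arguments.
Unset Strict Implicit.
Unset Printing Implicit Defensive.

Import Order.TTheory GRing.Theory Num.Theory.
Import numFieldNormedType.Exports.

Local Open Scope ring_scope.

(** * Minima over boxes and first-order conditions *)

(** Functions on [I] are read as row vectors, where boxes are compact and the extreme value theorem
    applies. *)
Lemma box_min (R : realType) (I : finType) (f : (I -> R) -> R) (B : R) :
  0 <= B ->
  continuous (fun x : 'rV[R]_#|I| => f (fun i => x ord0 (enum_rank i))) ->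
  exists2 x : I -> R, (forall i, `|x i| <= B) &
    forall y : I -> R, (forall i, `|y i| <= B) -> f x <= f y.
Proof.
move=> B0 cf.
set g := fun x : 'rV[R]_#|I| => f (fun i => x ord0 (enum_rank i)).
set K := [set x : 'rV[R]_#|I| | forall i, `[- B, B]%classic (x ord0 i)]%classic.
have K0 : (K !=set0)%classic.
  by exists 0 => i; rewrite /= mxE in_itv /=; lra.
have cK : compact K.
  apply: (@rV_compact _ _ (fun=> `[- B, B]%classic)) => i.
  exact: segment_compact.
have [x xK xmin] := EVT_min_rV K0 cK (continuous_subspaceT cf).
exists (fun i => x ord0 (enum_rank i)) => [i|y yB].
  by have := set_mem xK (enum_rank i); rewrite /= in_itv /= ler_norml.
have yK : (\row_j y (enum_val j)) \in K.
  by rewrite inE => j; rewrite /= in_itv /= mxE -ler_norml.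
have := xmin _ yK; rewrite /g.
suff -> : (fun i => (\row_j y (enum_val j)) ord0 (enum_rank i)) = y by [].
by apply/funext => i; rewrite mxE enum_rankK.
Qed.

Lemma continuous_sum (R : realType) (S : topologicalType) (I : Type)
    (r : seq I) (P : pred I) (F : I -> S -> R) :
  (forall i, continuous (F i)) ->
  continuous (fun x => \sum_(i <- r | P i) F i x).
Proof.
move=> cF; elim: r => [|i r IH].
  by rewrite (_ : (fun _ => _) = fun=> 0);
    [exact: cst_continuous | apply/funext => x; rewrite big_nil].
case: (boolP (P i)) => Pi.
  rewrite (_ : (fun _ => _) = fun x => F i x + \sum_(j <- r | P j) F j x).
    by move=> x; apply: continuousD; [exact: cF | exact: IH].
  by apply/funext => x; rewrite big_cons Pi.
rewrite (_ : (fun _ => _) = fun x => \sum_(j <- r | P j) F j x) //.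
by apply/funext => x; rewrite big_cons (negbTE Pi).
Qed.

Lemma first_order_ge0 (R : realType) (a b : R) :
  (forall h, 0 <= h <= 1 -> 0 <= h * a + h ^+ 2 * b) -> 0 <= a.
Proof.
move=> H; rewrite leNgt; apply/negP => a0.
(* At this [h], [a + h * b] is at most [h * a], which is negative. *)
set h := - a / (`|b| + - a).
have nb : b <= `|b| := ler_norm b.
have nb0 : 0 <= `|b| := normr_ge0 b.
have d0 : 0 < `|b| - a by lra.
have h0 : 0 < h by apply: divr_gt0; lra.
have hE : h * (`|b| - a) = - a by rewrite /h mulfVK // gt_eqF.
have h1 : h <= 1 by rewrite ler_pdivrMr //; lra.
have := H h; rewrite (ltW h0) h1 => /(_ isT).
rewrite expr2 -mulrA -mulrDr pmulr_rge0 //.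
have : h * b <= h * `|b| by rewrite ler_pM2l.
nra.
Qed.

Lemma continuous_mul (R : realType) (S : topologicalType) (f g : S -> R) :
  continuous f -> continuous g -> continuous (fun x => f x * g x).
Proof. by move=> cf cg x; apply: continuousM; [exact: cf | exact: cg]. Qed.

(** * Quadratic forms and semidefinite matrix completion *)

Definition qform (R : realType) (T : finType) (Y : T -> T -> R) (a : T -> R) :=
  \sum_u \sum_v Y u v * (a u * a v).

(** More columns than the dimension [#|T|] are dependent. The spare coordinate of the Gram vectors
    thus leaves a direction orthogonal to all of them. *)
Lemma kernel_vector (R : realType) (T : finType) (X : T -> 'I_#|T|.+1 -> R) :
  exists2 e : 'I_#|T|.+1 -> R, 0 < \sum_j e j ^+ 2 &
    forall u, \sum_j X u j * e j = 0.
Proof.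
set M := \matrix_(i < #|T|.+1, j < #|T|) X (enum_val j) i.
have : kermx M != 0.
  by rewrite kermx_eq0 /row_free neq_ltn (leq_ltn_trans (rank_leq_col M)).
case/rowV0Pn => v /sub_kermxP vM v0.
exists (fun j => v ord0 j).
  rewrite lt_def sumr_ge0 ?andbT => [|j _]; last exact: sqr_ge0.
  apply: contra v0 => /eqP v2; apply/eqP/rowP => j; rewrite mxE.
  have /(_ j isT)/eqP := psumr_eq0P (fun i _ => sqr_ge0 (v ord0 i)) v2.
  by rewrite sqrf_eq0 => /eqP.
move=> u; have /matrixP/(_ ord0 (enum_rank u)) := vM.
rewrite !mxE => vM0; rewrite -[RHS]vM0; apply: eq_bigr => j _.
by rewrite !mxE enum_rankK mulrC.
Qed.

(* Theorem of the alternative for semidefinite matrix completion; the vectors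
   come from the least-squares completion, and [Y] is its residual. *)
Lemma gram_completion (R : realType) (T : finType) (s : rel T)
    (b : T -> T -> R) :
  reflexive s -> symmetric s -> (forall u v, b u v = b v u) ->
  (exists X : T -> 'I_#|T|.+1 -> R,
      forall u v, s u v -> \sum_j X u j * X v j = b u v) \/
  (exists Y : T -> T -> R,
    [/\ forall u v, Y u v = Y v u, forall a, 0 <= qform Y a,
        forall u v, ~~ s u v -> Y u v = 0 &
        \sum_u \sum_v Y u v * b u v < 0]).
Proof.
move=> s_refl s_sym b_sym.
pose G (X : T * 'I_#|T|.+1 -> R) u v := \sum_j X (u, j) * X (v, j).
pose err (M : T -> T -> R) := \sum_u \sum_v (s u v)%:R * (M u v - b u v) ^+ 2.
pose beta := \sum_u \sum_v b u v ^+ 2.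
have beta_ge u v : b u v ^+ 2 <= beta.
  rewrite /beta (bigD1 u) //= (bigD1 v) //= -addrA lerDl addr_ge0 //.
    by apply: sumr_ge0 => *; exact: sqr_ge0.
  by apply: sumr_ge0 => *; apply: sumr_ge0 => *; exact: sqr_ge0.
have beta0 : 0 <= beta.
  by apply: sumr_ge0 => *; apply: sumr_ge0 => *; exact: sqr_ge0.
have err_ge M u v : s u v -> (M u v - b u v) ^+ 2 <= err M.
  have pos x y : 0 <= (s x y)%:R * (M x y - b x y) ^+ 2.
    by rewrite mulr_ge0 ?sqr_ge0.
  move=> suv; rewrite /err (bigD1 u) //= (bigD1 v) //= suv mul1r.
  rewrite -addrA lerDl addr_ge0 //.
    by apply: sumr_ge0 => *; exact: pos.
  by apply: sumr_ge0 => *; apply: sumr_ge0 => *; exact: pos.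
have G0 : G (fun=> 0) = fun _ _ => 0.
  by apply/funext => u; apply/funext => v; rewrite /G big1 // => j; rewrite mul0r.
have err0 : err (G (fun=> 0)) <= beta.
  rewrite G0; apply: ler_sum => u _; apply: ler_sum => v _; rewrite sub0r sqrrN.
  by case: (s u v); rewrite ?mul1r // mul0r sqr_ge0.
have B0 : 0 <= beta + 2 by lra.
have [|X0 X0B X0min] := @box_min R _ (fun X => err (G X)) (beta + 2) B0.
  have cc i : continuous (fun x : 'rV[R]_#|{: T * 'I_#|T|.+1}| => x ord0 i).
    by move=> x; exact: coord_continuous.
  apply: continuous_sum => u; apply: continuous_sum => v.
  apply: continuous_mul; first by move=> x; exact: cst_continuous.
  have cd : continuous (fun y : 'rV[R]_#|{: T * 'I_#|T|.+1}| =>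
      G (fun i => y ord0 (enum_rank i)) u v - b u v).
    move=> x; apply: continuousB; last exact: cst_continuous.
    by move: x; apply: continuous_sum => j; apply: continuous_mul; exact: cc.
  exact: (continuous_mul cd cd).
(* The box minimum is global: outside the box some diagonal Gram entry is at least
   [(beta + 2) ^+ 2], so the error is at least [beta], which bounds the error of the zero
   vectors. *)
have {}X0min X : err (G X0) <= err (G X).
  have [XB|] := pselect (forall i, `|X i| <= beta + 2); first exact: X0min.
  move/existsNP => -[[u j] /negP]; rewrite -ltNge => XB.
  have le0 : err (G X0) <= beta.
    by apply: le_trans err0; apply: X0min => i; rewrite normr0.
  apply: (le_trans le0); apply: (le_trans _ (err_ge _ u u (s_refl u))).
  have GB : (beta + 2) ^+ 2 <= G X u u.
    rewrite /G (bigD1 j) //= -expr2 -[leLHS]addr0 lerD //.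
      by rewrite -[leRHS]real_normK ?num_real // ler_pXn2r ?nnegrE // ltW.
    by apply: sumr_ge0 => i _; rewrite -expr2 sqr_ge0.
  have := beta_ge u u; have := sqr_ge0 (b u u - 1); nra.
pose M0 := G X0; pose Y u v := (s u v)%:R * (M0 u v - b u v).
have Y_sym u v : Y u v = Y v u.
  rewrite /Y s_sym b_sym /M0 /G; congr (_ * (_ - _)).
  by apply: eq_bigr => j _; rewrite mulrC.
have errD (N : T -> T -> R) h : err (fun u v => M0 u v + h * N u v) =
    err M0 + (h * (2 * \sum_u \sum_v Y u v * N u v) +
              h ^+ 2 * \sum_u \sum_v (s u v)%:R * N u v ^+ 2).
  rewrite !mulr_sumr -!big_split /=; apply: eq_bigr => u _.
  rewrite !mulr_sumr -!big_split /=; apply: eq_bigr => v _.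
  by rewrite /Y; ring.
(* If [M0 + h * N] remains a Gram matrix for all [h] in [0, 1], minimality makes the derivative of
   the error along [N] nonnegative. *)
have dirP N : (forall h, 0 <= h <= 1 -> exists X, G X = fun u v => M0 u v + h * N u v) ->
    0 <= \sum_u \sum_v Y u v * N u v.
  move=> H; rewrite -(@pmulr_rge0 _ 2) //.
  apply: (@first_order_ge0 _ _ (\sum_u \sum_v (s u v)%:R * N u v ^+ 2)) => h h01.
  have [X GX] := H h h01; have := X0min X.
  by rewrite GX errD lerDl.
have [Y0|Yn0] := pselect (forall u v, Y u v = 0).
  left; exists (fun u j => X0 (u, j)) => u v suv.
  by have := Y0 u v; rewrite /Y suv mul1r => /eqP; rewrite subr_eq0 => /eqP.
right; exists Y; split => //.
- move=> a; apply: dirP => h /andP[h0 _].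
  (* Moving the vectors along [e], with multiples [a u], adds exactly [h * (a u * a v)] to the Gram
     matrix: the cross terms vanish by orthogonality. *)
  have [e e0 Xe] := kernel_vector (fun u j => X0 (u, j)).
  set E := \sum_j e j ^+ 2 in e0.
  exists (fun i => X0 i + Num.sqrt (h / E) * (a i.1 * e i.2)).
  apply/funext => u; apply/funext => v; rewrite /G /=.
  transitivity (M0 u v + Num.sqrt (h / E) ^+ 2 * E * (a u * a v) +
     Num.sqrt (h / E) * (a v * (\sum_j X0 (u, j) * e j) +
                         a u * (\sum_j X0 (v, j) * e j))).
    rewrite /M0 /G /E !mulr_sumr mulr_suml -!big_split /= mulr_sumr -big_split /=.
    by apply: eq_bigr => j _; ring.
  rewrite !Xe !mulr0 addr0 mulr0 addr0 sqr_sqrtr; last by rewrite divr_ge0 // ltW.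
  by rewrite mulfVK // gt_eqF.
- by move=> u v /negbTE suv; rewrite /Y suv mul0r.
(* Shrinking all vectors realizes the direction [- M0]. As [b = M0 - Y] on the pattern [s], this
   leaves the pairing of [Y] with [b] at most minus the squared norm of [Y]. *)
have YM : 0 <= \sum_u \sum_v Y u v * - M0 u v.
  apply: dirP => h /andP[h0 h1]; exists (fun i => Num.sqrt (1 - h) * X0 i).
  apply/funext => u; apply/funext => v.
  transitivity (Num.sqrt (1 - h) ^+ 2 * M0 u v).
    by rewrite /G mulr_sumr; apply: eq_bigr => j _; ring.
  by rewrite sqr_sqrtr; [ring | lra].
have Yb : \sum_u \sum_v Y u v * b u v =
    - (\sum_u \sum_v Y u v * - M0 u v) - \sum_u \sum_v Y u v ^+ 2.
  rewrite -!sumrN -big_split; apply: eq_bigr => u _ /=.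
  rewrite -!sumrN -big_split; apply: eq_bigr => v _ /=.
  by rewrite /Y; case: (s u v); rewrite ?mul1r ?mul0r; ring.
have Y2 : 0 < \sum_u \sum_v Y u v ^+ 2.
  move/existsNP: Yn0 => -[u /existsNP[v /eqP Yuv]].
  rewrite (bigD1 u) //= (bigD1 v) //= -addrA ltr_pwDl //.
    by rewrite lt_def sqr_ge0 sqrf_eq0 Yuv.
  rewrite addr_ge0 //; first by apply: sumr_ge0 => *; exact: sqr_ge0.
  by apply: sumr_ge0 => *; apply: sumr_ge0 => *; exact: sqr_ge0.
by rewrite Yb; lra.
Qed.

(** * Semidefinite matrices supported on a graph *)

Lemma psd_diag_ge0 (R : realType) (T : finType) (Y : T -> T -> R) (u : T) :
  (forall a, 0 <= qform Y a) -> 0 <= Y u u.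
Proof.
move=> /(_ (fun v => (v == u)%:R)); rewrite /qform (bigD1 u) //= (bigD1 u) //=.
rewrite eqxx !mulr1 big1 ?addr0 => [|v /negbTE ->]; last by rewrite !mulr0.
rewrite big1 ?addr0 // => v /negbTE ->.
by rewrite big1 // => w _; rewrite mul0r mulr0.
Qed.

(** Nonnegativity of the form is summed over all pairs of colors [c], [d], testing [a] on class [c]
    minus [a] on class [d]. The pair [u], [v] then gets coefficient [2 * (r * [f u = f v] - 1)], and
    monochromatic off-diagonal terms vanish. *)
Lemma qform_colorable (R : realType) (T : finType) (e : rel T)
    (Y : T -> T -> R) (r : nat) (f : T -> 'I_r) (a : T -> R) :
  (forall a, 0 <= qform Y a) ->
  (forall u v, u != v -> ~~ e u v -> Y u v = 0) ->
  (forall u v, a u != 0 -> a v != 0 -> e u v -> f u != f v) ->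
  qform Y a <= r%:R * \sum_u a u ^+ 2 * Y u u.
Proof.
move=> Ypsd Yse fcol.
have H : 0 <= \sum_(c < r) \sum_(d < r)
    qform Y (fun u => a u * ((f u == c)%:R - (f u == d)%:R)).
  by apply: sumr_ge0 => c _; apply: sumr_ge0 => d _; exact: Ypsd.
suff E : \sum_(c < r) \sum_(d < r)
    qform Y (fun u => a u * ((f u == c)%:R - (f u == d)%:R)) =
    2 * (r%:R * \sum_u a u ^+ 2 * Y u u - qform Y a).
  by move: H; rewrite E pmulr_rge0 // subr_ge0.
have ind (x : 'I_r) : \sum_(c < r) (x == c)%:R = 1 :> R.
  by rewrite (bigD1 x) //= eqxx big1 ?addr0 // => c; rewrite eq_sym => /negbTE ->.
have ind2 (x y : 'I_r) : \sum_(c < r) (x == c)%:R * (y == c)%:R = (x == y)%:R :> R.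
  rewrite (bigD1 x) //= eqxx mul1r eq_sym big1 ?addr0 // => c.
  by rewrite eq_sym => /negbTE ->; rewrite mul0r.
have card1 : \sum_(c < r) 1 = r%:R :> R by rewrite sumr_const card_ord.
have pair (x y : 'I_r) : \sum_(c < r) \sum_(d < r)
    (((x == c)%:R - (x == d)%:R) * ((y == c)%:R - (y == d)%:R)) =
    2 * (r%:R * (x == y)%:R - 1) :> R.
  transitivity (\sum_(c < r) (r%:R * ((x == c)%:R * (y == c)%:R)
     - (x == c)%:R - (y == c)%:R + (x == y)%:R) : R).
    apply: eq_bigr => c _.
    transitivity (\sum_(d < r) ((x == c)%:R * (y == c)%:R * 1
      - (x == c)%:R * (y == d)%:R - (y == c)%:R * (x == d)%:R
      + (x == d)%:R * (y == d)%:R) : R).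
      by apply: eq_bigr => d _; ring.
    by rewrite !big_split /= !sumrN -!mulr_sumr card1 !ind ind2; ring.
  rewrite !big_split /= !sumrN -mulr_sumr ind2 !ind sumr_const card_ord -mulr_natl.
  by ring.
transitivity (\sum_u \sum_v Y u v * (a u * a v) * (2 * (r%:R * (f u == f v)%:R - 1))).
  under eq_bigr => c _ do rewrite exchange_big /=.
  rewrite exchange_big /=; apply: eq_bigr => u _.
  under eq_bigr => c _ do rewrite exchange_big /=.
  rewrite exchange_big /=; apply: eq_bigr => v _.
  rewrite -pair mulr_sumr; apply: eq_bigr => c _.
  by rewrite mulr_sumr; apply: eq_bigr => d _; ring.
rewrite mulrBr mulrA /qform mulr_sumr mulr_sumr -sumrN -big_split /=.
apply: eq_bigr => u _; rewrite mulr_sumr -sumrN.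
rewrite [in RHS](bigD1 u) //= [in LHS](bigD1 u) //= eqxx addrA; congr (_ + _).
  by rewrite mulr1n; ring.
apply: eq_bigr => v vu.
have [euv|neuv] := boolP (e u v); last first.
  by rewrite Yse 1?eq_sym //; ring.
have [->|au] := eqVneq (a u) 0; first by ring.
have [->|av] := eqVneq (a v) 0; first by ring.
by rewrite (negbTE (fcol u v au av euv)) mulr0n; ring.
Qed.

(* The weighted row sum is [qform Y g] plus half the sum of
   [Y u v * (g u - g v) ^+ 2], to which only edges between consecutive levels
   contribute.  That the increments enter squared is the source of the exponent
   1/2 of delta in the theorem. *)
Lemma level_row_sum (R : realType) (T : finType) (e : rel T)
    (Y : T -> T -> R) (r m : nat) (f : T -> 'I_r) (lev : T -> nat)
    (g : nat -> R) :
  (forall a, 0 <= qform Y a) -> (forall u v, Y u v = Y v u) ->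
  (forall u v, u != v -> ~~ e u v -> Y u v = 0) -> symmetric e ->
  (forall u v, e u v -> (lev v <= (lev u).+1)%N) ->
  (forall u v, (lev u <= m)%N -> (lev v <= m)%N -> e u v -> f u != f v) ->
  (forall l, (m <= l)%N -> g l = 0) ->
  \sum_u g (lev u) ^+ 2 * \sum_v Y u v <=
  r%:R * \sum_u g (lev u) ^+ 2 * Y u u +
  \sum_(l < m) (g l - g l.+1) ^+ 2 * (r%:R / 2 *
     \sum_u ((lev u == l)%:R + (lev u == l.+1)%:R) * Y u u).
Proof.
move=> Ypsd Ysym Yse esym elev fcol g0.
have Qg : qform Y (fun u => g (lev u)) <= r%:R * \sum_u g (lev u) ^+ 2 * Y u u.
  apply: (qform_colorable (f := f) Ypsd Yse) => u v gu gv; apply: fcol.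
    by rewrite leqNgt; apply: contra gu => /ltnW/g0 ->.
  by rewrite leqNgt; apply: contra gv => /ltnW/g0 ->.
pose I l u : R := (lev u == l)%:R.
have I0 l u : I l u != 0 -> lev u = l.
  by rewrite /I; have [->|_] := eqVneq (lev u) l; rewrite // mulr0n eqxx.
have I2 l u : I l u ^+ 2 = I l u.
  by rewrite /I; case: (lev u == l); rewrite ?expr1n ?expr0n.
(* Level [m] is included although [g m = 0], since the step from level [m - 1] ends there. *)
have QI l : (l <= m)%N -> qform Y (I l) <= r%:R * \sum_u I l u * Y u u.
  move=> lm; rewrite (_ : \sum_u I l u * Y u u = \sum_u I l u ^+ 2 * Y u u).
    apply: (qform_colorable (f := f) Ypsd Yse) => u v /I0 lu /I0 lv.
    by apply: fcol; rewrite ?lu ?lv.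
  by apply: eq_bigr => u _; rewrite I2.
(* Nonnegativity at the difference of the two level indicators bounds the cross terms by the forms
   on the single levels. *)
have QII l : (l < m)%N ->
    \sum_u \sum_v Y u v * (I l u * I l.+1 v + I l v * I l.+1 u) <=
    r%:R * \sum_u (I l u + I l.+1 u) * Y u u.
  move=> lm; have := Ypsd (fun u => I l u - I l.+1 u).
  have -> : qform Y (fun u => I l u - I l.+1 u) = qform Y (I l) + qform Y (I l.+1)
      - \sum_u \sum_v Y u v * (I l u * I l.+1 v + I l v * I l.+1 u).
    rewrite /qform -sumrN -!big_split; apply: eq_bigr => u _ /=.
    by rewrite -sumrN -!big_split; apply: eq_bigr => v _ /=; ring.
  have := QI l (ltnW lm); have := QI l.+1 lm.
  under [X in _ -> _ -> _ -> _ <= r%:R * X]eq_bigr => u _ do rewrite mulrDl.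
  by rewrite big_split /=; lra.
have jump (a : nat) : \sum_(l < m) (g l - g l.+1) ^+ 2 * (a == l)%:R = (g a - g a.+1) ^+ 2.
  have [am|ma] := ltnP a m.
    rewrite (bigD1 (Ordinal am)) //= eqxx mulr1 big1 ?addr0 // => l.
    by rewrite -val_eqE eq_sym /= => /negbTE ->; rewrite mulr0.
  rewrite (g0 a) // (g0 a.+1) ?(leqW ma) // subrr expr0n big1 // => l _.
  by rewrite gtn_eqF ?mulr0 // (leq_trans (ltn_ord l)).
(* Levels of adjacent vertices differ by at most one, so a squared increment is a single step of
   [g], or zero. *)
have jumps (a b : nat) : (a <= b.+1)%N -> (b <= a.+1)%N -> (g a - g b) ^+ 2 =
    \sum_(l < m) (g l - g l.+1) ^+ 2 *
      ((a == l)%:R * (b == l.+1)%:R + (b == l)%:R * (a == l.+1)%:R).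
  have ne (k l : nat) : (k == l)%:R * (k == l.+1)%:R = 0 :> R.
    by case: eqP => [->|]; rewrite ?mul0r // ltn_eqF ?mulr0.
  have ne2 (k l : nat) : (k.+1 == l)%:R * (k == l.+1)%:R = 0 :> R.
    by case: eqP => [<-|]; rewrite ?mul0r // ltn_eqF ?mulr0.
  have id2 (k l : nat) : (k == l)%:R * (k.+1 == l.+1)%:R = (k == l)%:R :> R.
    by rewrite eqSS; case: eqP; rewrite ?mulr1 ?mul0r.
  move=> ab ba; have [ltab|ltba|->] := ltngtP a b.
  - have -> : b = a.+1 by apply/eqP; rewrite eqn_leq ba.
    by rewrite -jump; apply: eq_bigr => l _; rewrite id2 ne2 addr0.
  - have -> : a = b.+1 by apply/eqP; rewrite eqn_leq ab.
    rewrite -[LHS]sqrrN opprB -jump; apply: eq_bigr => l _.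
    by rewrite id2 ne2 add0r.
  - by rewrite subrr expr0n big1 // => l _; rewrite ne addr0 mulr0.
pose S := \sum_u \sum_v Y u v * g (lev u) ^+ 2.
have -> : \sum_u g (lev u) ^+ 2 * \sum_v Y u v = S.
  by apply: eq_bigr => u _; rewrite mulr_sumr; apply: eq_bigr => v _; rewrite mulrC.
have S_sym : S = \sum_u \sum_v Y u v * g (lev v) ^+ 2.
  rewrite /S exchange_big /=; apply: eq_bigr => u _.
  by apply: eq_bigr => v _; rewrite Ysym.
have SD : \sum_u \sum_v Y u v * (g (lev u) - g (lev v)) ^+ 2 =
    2 * S - 2 * qform Y (fun u => g (lev u)).
  rewrite [2 * S](_ : _ = S + S); last by ring.
  rewrite {2}S_sym /S /qform mulr_sumr -sumrN -!big_split; apply: eq_bigr => u _ /=.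
  by rewrite mulr_sumr -sumrN -!big_split; apply: eq_bigr => v _ /=; ring.
suff SL : \sum_u \sum_v Y u v * (g (lev u) - g (lev v)) ^+ 2 <=
    2 * \sum_(l < m) (g l - g l.+1) ^+ 2 * (r%:R / 2 *
     \sum_u ((lev u == l)%:R + (lev u == l.+1)%:R) * Y u u) by lra.
have -> : \sum_u \sum_v Y u v * (g (lev u) - g (lev v)) ^+ 2 =
    \sum_(l < m) (g l - g l.+1) ^+ 2 *
      \sum_u \sum_v Y u v * (I l u * I l.+1 v + I l v * I l.+1 u).
  under [RHS]eq_bigr => l _ do rewrite mulr_sumr.
  rewrite [RHS]exchange_big; apply: eq_bigr => u _ /=.
  under [RHS]eq_bigr => l _ do rewrite mulr_sumr.
  rewrite [RHS]exchange_big; apply: eq_bigr => v _ /=.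
  under eq_bigr => l _ do rewrite mulrCA.
  rewrite -mulr_sumr; have [->|uv] := eqVneq u v.
    by rewrite (jumps (lev v) (lev v)).
  have [euv|neuv] := boolP (e u v); last by rewrite Yse ?mul0r.
  by rewrite jumps //; apply: elev => //; rewrite esym.
rewrite mulr_sumr; apply: ler_sum => l _.
by have := QII l (ltn_ord l); have := sqr_ge0 (g l - g l.+1); rewrite /I; nra.
Qed.

(** For a truncated geometric weight, [level_row_sum] has error at most [r / 2 * lam ^+ 2 * 20 * S],
    where [S] is the weighted diagonal sum. Dividing by [S] gives the constant 10. *)
Lemma heavy_center_bound (R : realType) (T : finType) (e : rel T)
    (Y : T -> T -> R) (r m : nat) (f : T -> 'I_r) (lev : T -> nat) (c : T)
    (t lam : R) :
  (forall a, 0 <= qform Y a) -> (forall u v, Y u v = Y v u) ->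
  (forall u v, u != v -> ~~ e u v -> Y u v = 0) -> symmetric e ->
  (forall u v, e u v -> (lev v <= (lev u).+1)%N) ->
  (forall u v, (lev u <= m)%N -> (lev v <= m)%N -> e u v -> f u != f v) ->
  lev c = 0%N -> (forall u, Y u u <= Y c c) -> 0 < Y c c ->
  (forall u, t * Y u u <= \sum_v Y u v) ->
  0 <= lam <= 1 / 2 -> (1 - lam) ^+ m <= (2 * #|T|%:R)^-1 ->
  t <= r%:R * (1 + 10 * lam ^+ 2).
Proof.
move=> Ypsd Ysym Yse esym elev fcol levc cmax Ycc row /andP[l0 l1] bm.
set n : R := #|T|%:R; set b : R := 1 - lam; set eta : R := (2 * n)^-1.
have n1 : 1 <= n by rewrite ler1n; apply/card_gt0P; exists c.
have eta0 : 0 < eta by rewrite invr_gt0; lra.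
have etan : eta * n = 1 / 2.
  by rewrite /eta; field; rewrite gt_eqF //; lra.
have eta1 : eta <= 1 / 2 by rewrite -etan ler_peMr // ltW.
have b0 : 1 / 2 <= b <= 1 by rewrite /b; apply/andP; split; lra.
have bp l : 0 <= b ^+ l by apply: exprn_ge0; lra.
(* [eta] is so small that the mass [eta ^+ 2 * n * Y c c] lost by cutting off
   the tail of the weight is dominated by the contribution of the center. *)
pose g l := Num.max (b ^+ l - eta) 0.
have g0 l : (m <= l)%N -> g l = 0.
  move=> ml; rewrite /g max_r // subr_le0; apply: le_trans bm.
  by apply: ler_wiXn2l => //; lra.
have gb l : b ^+ l <= g l + eta.
  by have : b ^+ l - eta <= g l; [rewrite le_max lexx | lra].
have gge l : 0 <= g l by rewrite le_max lexx orbT.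
have gstep l : (g l - g l.+1) ^+ 2 <= lam ^+ 2 * (b ^+ l) ^+ 2.
  have -> : lam ^+ 2 * (b ^+ l) ^+ 2 = (b ^+ l - b ^+ l.+1) ^+ 2.
    by rewrite (exprS b l) /b; ring.
  have mono : b ^+ l.+1 <= b ^+ l by rewrite exprS ler_piMl //; lra.
  have : 0 <= g l - g l.+1 <= b ^+ l - b ^+ l.+1.
    rewrite /g; case: (lerP (b ^+ l - eta) 0); case: (lerP (b ^+ l.+1 - eta) 0); lra.
  nra.
have Yd u : 0 <= Y u u by exact: psd_diag_ge0.
set S := \sum_u g (lev u) ^+ 2 * Y u u.
(* The center alone suffices, as [g 0] is at least [1 - eta], hence at least 1/2. *)
have S_ge : Y c c / 4 <= S.
  rewrite /S (bigD1 c) //= levc -[leLHS]addr0 lerD //.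
    have gb0 := gb 0%N; rewrite expr0 in gb0.
    have : 1 / 4 <= g 0%N ^+ 2 by have := gge 0%N; nra.
    by nra.
  by apply: sumr_ge0 => u _; rewrite mulr_ge0 ?sqr_ge0.
have H1 : t * S <= \sum_u g (lev u) ^+ 2 * \sum_v Y u v.
  rewrite mulr_sumr; apply: ler_sum => u _; rewrite mulrCA.
  by rewrite ler_wpM2l ?sqr_ge0.
have H2 := level_row_sum Ypsd Ysym Yse esym elev fcol g0.
have pick (F : nat -> R) (k : nat) : (forall l, 0 <= F l) ->
    \sum_(l < m) F l * (k == l :> nat)%:R <= F k.
  move=> F0; have [km|mk] := ltnP k m.
    rewrite (bigD1 (Ordinal km)) //= eqxx mulr1 big1 ?addr0 // => l.
    by rewrite -val_eqE eq_sym /= => /negbTE ->; rewrite mulr0.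
  rewrite big1 // => l _.
  by rewrite gtn_eqF ?mulr0 // (leq_trans (ltn_ord l)).
have H3 : \sum_(l < m) (g l - g l.+1) ^+ 2 * (r%:R / 2 *
     \sum_u ((lev u == l)%:R + (lev u == l.+1)%:R) * Y u u) <=
   r%:R / 2 * lam ^+ 2 * \sum_u 5 * (b ^+ lev u) ^+ 2 * Y u u.
  apply: (@le_trans _ _ (\sum_(l < m) lam ^+ 2 * (b ^+ l) ^+ 2 * (r%:R / 2 *
     \sum_u ((lev u == l)%:R + (lev u == l.+1)%:R) * Y u u))).
    apply: ler_sum => l _; apply: ler_wpM2r; last exact: gstep.
    apply: mulr_ge0; first by rewrite divr_ge0.
    by apply: sumr_ge0 => u _; rewrite mulr_ge0 // addr_ge0.
  have -> : \sum_(l < m) lam ^+ 2 * (b ^+ l) ^+ 2 * (r%:R / 2 *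
     \sum_u ((lev u == l)%:R + (lev u == l.+1)%:R) * Y u u) =
     r%:R / 2 * lam ^+ 2 * \sum_u (\sum_(l < m) (b ^+ l) ^+ 2 *
       ((lev u == l)%:R + (lev u == l.+1)%:R)) * Y u u.
    under [in RHS]eq_bigr => u _ do rewrite mulr_suml.
    rewrite exchange_big /= mulr_sumr; apply: eq_bigr => l _.
    rewrite !mulr_sumr; apply: eq_bigr => u _; ring.
  apply: ler_wpM2l; first by rewrite mulr_ge0 ?sqr_ge0 ?divr_ge0.
  apply: ler_sum => u _; apply: ler_wpM2r => //.
  have p1 := pick (fun l => (b ^+ l) ^+ 2) (lev u) (fun l => sqr_ge0 _).
  (* Going down one level costs [b ^- 2], at most 4; with the term from [p1] this makes the factor
     5. *)
  have p2 : \sum_(l < m) (b ^+ l) ^+ 2 * (lev u == l.+1)%:R <= 4 * (b ^+ lev u) ^+ 2.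
    case: (lev u) => [|k].
      rewrite big1 => [|l _]; last by rewrite mulr0.
      by rewrite mulr_ge0 // sqr_ge0.
    apply: le_trans (pick (fun l => (b ^+ l) ^+ 2) k (fun l => sqr_ge0 _)) _.
    rewrite (exprS b k) exprMn; have := sqr_ge0 (b ^+ k);
      have : 1 / 4 <= b ^+ 2 by case/andP: b0 => b1 _; rewrite expr2; nra.
    by rewrite mulrA; nra.
  under eq_bigr => l _ do rewrite mulrDr.
  by rewrite big_split /=; lra.
(* From [b ^+ l <= g l + eta], the squares cost [10 * S] plus a tail [5 * eta * Y c c], itself at
   most [10 * S] by [S_ge]. *)
have H4 : \sum_u 5 * (b ^+ lev u) ^+ 2 * Y u u <= 20 * S.
  have : \sum_u 5 * (b ^+ lev u) ^+ 2 * Y u u <=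
      \sum_u (10 * (g (lev u) ^+ 2 * Y u u) + 10 * eta ^+ 2 * Y c c).
    apply: ler_sum => u _.
    have b2 : (b ^+ lev u) ^+ 2 <= 2 * g (lev u) ^+ 2 + 2 * eta ^+ 2.
      have := gb (lev u); have := bp (lev u); have := gge (lev u).
      by have := sqr_ge0 (g (lev u) - eta); nra.
    have : (b ^+ lev u) ^+ 2 * Y u u <= (2 * g (lev u) ^+ 2 + 2 * eta ^+ 2) * Y u u.
      by rewrite ler_wpM2r.
    have : eta ^+ 2 * Y u u <= eta ^+ 2 * Y c c by rewrite ler_wpM2l ?sqr_ge0.
    lra.
  rewrite big_split /= -mulr_sumr -/S sumr_const -mulr_natl -/n => le1.
  have : n * (10 * eta ^+ 2 * Y c c) <= 10 * S.
    have -> : n * (10 * eta ^+ 2 * Y c c) = 10 * (eta * n) * eta * Y c c by ring.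
    by rewrite etan; nra.
  lra.
have S0 : 0 < S by lra.
have H5 : r%:R / 2 * lam ^+ 2 * \sum_u 5 * (b ^+ lev u) ^+ 2 * Y u u <=
   r%:R / 2 * lam ^+ 2 * (20 * S).
  by apply: ler_wpM2l => //; rewrite mulr_ge0 ?sqr_ge0 ?divr_ge0.
rewrite -(ler_pM2r S0).
apply: le_trans H1 (le_trans H2 (le_trans (lerD (lexx _) (le_trans H3 H5)) _)).
by rewrite -/S; lra.
Qed.

(** * Rescaling to nonnegative row sums *)

(** Take [x] maximizing the form on the box of side [-1, 1]. Shrinking one coordinate towards 0
    stays in the box, so the first-order condition makes its row sum nonnegative; comparison with
    the all-ones vector gives positivity. *)
Lemma box_scaling (R : realType) (T : finType) (Z : T -> T -> R) :
  (forall u v, Z u v = Z v u) -> 0 < \sum_u \sum_v Z u v ->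
  exists x : T -> R, (forall u, 0 <= \sum_v Z u v * (x u * x v)) /\
    0 < qform Z x.
Proof.
move=> Zsym Z1.
have [|x xB xmin] := @box_min R T (fun a => - qform Z a) 1 ler01.
  have cc i : continuous (fun x : 'rV[R]_#|T| => x ord0 i).
    by move=> x; exact: coord_continuous.
  have cq : continuous (fun x : 'rV[R]_#|T| =>
      qform Z (fun i => x ord0 (enum_rank i))).
    apply: continuous_sum => u; apply: continuous_sum => v.
    apply: continuous_mul; first by move=> x; exact: cst_continuous.
    by apply: continuous_mul; exact: cc.
  by move=> x; apply: continuousN; exact: cq.
exists x; split; last first.
  have le1 : qform Z (fun=> 1) <= qform Z x.
    by rewrite -lerN2; apply: xmin => i; rewrite normr1.
  apply: lt_le_trans le1.
  by rewrite /qform; under eq_bigr => u _ do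
    under eq_bigr => v _ do rewrite !mulr1.
move=> w; rewrite -(@pmulr_rge0 _ 2) //.
apply: (@first_order_ge0 _ _ (- (Z w w * (x w * x w)))) => h /andP[h0 h1].
pose d u : R := (u == w)%:R.
have yB u : `|x u * (1 - h * d u)| <= 1.
  rewrite normrM mulr_ile1 ?normr_ge0 // /d ler_norml.
  by case: (u == w); rewrite ?mulr1n ?mulr0n; apply/andP; split; lra.
have := xmin _ yB; rewrite lerN2.
have pick (F : T -> R) : \sum_u d u * F u = F w.
  rewrite (bigD1 w) //= /d eqxx mul1r big1 ?addr0 // => u /negbTE ->.
  by rewrite mul0r.
suff -> : qform Z (fun u => x u * (1 - h * d u)) = qform Z x -
  (h * (2 * \sum_v Z w v * (x w * x v)) + h ^+ 2 * - (Z w w * (x w * x w))) by lra.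
have E1 : \sum_v Z w v * (x w * x v) =
    \sum_u \sum_v d u * (Z u v * (x u * x v)).
  by rewrite -(pick (fun u => \sum_v Z u v * (x u * x v))); apply: eq_bigr => u _;
    rewrite mulr_sumr.
have E2 : \sum_v Z w v * (x w * x v) =
    \sum_u \sum_v d v * (Z u v * (x u * x v)).
  apply: eq_bigr => u _; rewrite (pick (fun v => Z u v * (x u * x v))) Zsym.
  by rewrite (mulrC (x w)).
have E3 : Z w w * (x w * x w) = \sum_u \sum_v d u * (d v * (Z u v * (x u * x v))).
  under [RHS]eq_bigr => u _ do rewrite -mulr_sumr.
  by rewrite pick pick.
rewrite [2 * _](_ : _ = \sum_v Z w v * (x w * x v) + \sum_v Z w v * (x w * x v));
  last by ring.
rewrite E3 {1}E1 E2 /qform -big_split /= -sumrN mulr_sumr mulr_sumr -big_split /=.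
rewrite -sumrN -big_split /=; apply: eq_bigr => u _.
rewrite -big_split /= -sumrN mulr_sumr mulr_sumr -big_split /= -sumrN -big_split /=.
by apply: eq_bigr => v _; ring.
Qed.

(** * Balls and distance levels *)

Fixpoint ball (T : finType) (e : rel T) (c : T) (l : nat) : {set T} :=
  if l is l'.+1
  then ball e c l' :|: [set v | [exists u in ball e c l', e u v]]%SET
  else [set c]%SET.

Lemma ballS (T : finType) (e : rel T) (c u v : T) (l : nat) :
  u \in ball e c l -> e u v -> v \in ball e c l.+1.
Proof.
move=> ul euv; rewrite /= !inE; apply/orP; right.
by apply/existsP; exists u; rewrite ul.
Qed.

Lemma sub_ball (T : finType) (e : rel T) (c : T) (l m : nat) :
  (l <= m)%N -> ball e c l \subset ball e c m.
Proof.
move=> /subnK <-; elim: (m - l)%N => [|d IH]; first exact: subxx.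
by apply: (fintype.subset_trans IH); rewrite addSn /= finset.subsetUl.
Qed.

(* The distance from [c], truncated at [m.+1]. *)
Definition level (T : finType) (e : rel T) (c : T) (m : nat) (u : T) : nat :=
  find (fun l => u \in ball e c l) (iota 0 m.+1).

Lemma level_le (T : finType) (e : rel T) (c : T) (m l : nat) (u : T) :
  (l <= m)%N -> u \in ball e c l -> (level e c m u <= l)%N.
Proof.
move=> lm ul; rewrite leqNgt; apply/negP => /(before_find 0%N).
by rewrite nth_iota // add0n ul.
Qed.

Lemma mem_ball_level (T : finType) (e : rel T) (c : T) (m : nat) (u : T) :
  (level e c m u <= m)%N -> u \in ball e c (level e c m u).
Proof.
move=> lm; have : has (fun l => u \in ball e c l) (iota 0 m.+1).
  by rewrite has_find size_iota.
by move/(nth_find 0%N); rewrite nth_iota // add0n.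
Qed.

Lemma level_edge (T : finType) (e : rel T) (c : T) (m : nat) (u v : T) :
  e u v -> (level e c m v <= (level e c m u).+1)%N.
Proof.
move=> euv; have [lt_m|le_m] := ltnP (level e c m u) m.
  by apply: level_le => //; apply: ballS euv; apply/mem_ball_level/ltnW.
apply: (@leq_trans m.+1) => //.
by have := find_size (fun l => v \in ball e c l) (iota 0 m.+1); rewrite size_iota.
Qed.

(** * From local colorings to vector colorings *)

Lemma vector_coloring (R : realType) (T : finType) (e : rel T) (r m : nat)
    (t lam : R) :
  symmetric e -> irreflexive e ->
  0 <= lam <= 1 / 2 -> (1 - lam) ^+ m <= (2 * #|T|%:R)^-1 ->
  (forall c, exists f : T -> 'I_r,
     forall u v, u \in ball e c m -> v \in ball e c m -> e u v -> f u != f v) ->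
  r%:R * (1 + 10 * lam ^+ 2) < t ->
  exists X : T -> 'I_#|T|.+1 -> R,
    (forall u, \sum_j X u j * X u j = t - 1) /\
    (forall u v, e u v -> \sum_j X u j * X v j = -1).
Proof.
move=> esym eirr lam01 lamm balls tbig.
pose s (u v : T) := (u == v) || e u v.
pose b (u v : T) : R := if u == v then t - 1 else -1.
have srefl : reflexive s by move=> u; rewrite /s eqxx.
have ssym : symmetric s by move=> u v; rewrite /s eq_sym esym.
have bsym u v : b u v = b v u by rewrite /b eq_sym.
have [[X XP]|[Y [Ysym Ypsd Ys Yb]]] := gram_completion srefl ssym bsym.
  exists X; split => [u|u v euv]; first by rewrite XP ?srefl // /b eqxx.
  rewrite XP /s ?euv ?orbT // /b; case: eqVneq => // uv.
  by move: euv; rewrite uv eirr.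
exfalso.
have Yse u v : u != v -> ~~ e u v -> Y u v = 0.
  by move=> uv euv; apply: Ys; rewrite /s negb_or uv.
(* The total of [Z] is the total of [Y] minus [t] times its trace, and after scaling its row sums
   compare those of [Y'] with [t * Y' u u]. *)
pose Z u v := - (Y u v * b u v).
have Zsym u v : Z u v = Z v u by rewrite /Z Ysym bsym.
have Z1 : 0 < \sum_u \sum_v Z u v.
  by under eq_bigr => u _ do rewrite sumrN; rewrite sumrN oppr_gt0.
have [x [xrow xpos]] := box_scaling Zsym Z1.
pose Y' u v := Y u v * (x u * x v).
have qY' a : qform Y' a = qform Y (fun u => x u * a u).
  by apply: eq_bigr => u _; apply: eq_bigr => v _; rewrite /Y'; ring.
have Y'psd a : 0 <= qform Y' a by rewrite qY'.
have Y'sym u v : Y' u v = Y' v u by rewrite /Y' Ysym (mulrC (x u)).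
have Y'se u v : u != v -> ~~ e u v -> Y' u v = 0.
  by move=> uv euv; rewrite /Y' Yse ?mul0r.
have rowE u : \sum_v Z u v * (x u * x v) = \sum_v Y' u v - t * Y' u u.
  rewrite (bigD1 u) //= [in RHS](bigD1 u) //= /Z /Y' /b eqxx.
  rewrite addrAC; congr (_ + _); first by ring.
  by apply: eq_bigr => v; rewrite eq_sym => /negbTE ->; ring.
have row u : t * Y' u u <= \sum_v Y' u v by rewrite -subr_ge0 -rowE.
have Y'd u : 0 <= Y' u u by exact: psd_diag_ge0.
have [c cpos] : exists c, 0 < Y' c c.
  apply/not_existsP => Y0.
  have Y'0 u : Y' u u = 0.
    by apply/eqP; rewrite eq_le Y'd andbT leNgt; apply/negP/Y0.
  (* Giving each vertex its own color, a zero diagonal would force the form at the all-ones vector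
     to be at most 0, against [xpos]. *)
  have := @qform_colorable R T e Y' _ enum_rank (fun=> 1) Y'psd Y'se.
  rewrite [X in _ * X]big1 ?mulr0 => [|u _]; last by rewrite Y'0 mulr0.
  have -> : qform Y' (fun=> 1) = qform Z x.
    apply: eq_bigr => u _; rewrite rowE Y'0 mulr0 subr0.
    by apply: eq_bigr => v _; rewrite !mulr1.
  move=> /(_ _); rewrite leNgt xpos => /(_ _)/negP; apply => // u v _ _ euv.
  by rewrite (inj_eq enum_rank_inj); apply: contraTneq euv => ->; rewrite eirr.
pose d := [arg max_(d > c) Y' d d]%O.
have dmax u : Y' u u <= Y' d d.
  by rewrite /d; case: arg_maxP => // i _ /(_ u); apply.
have [f fP] := balls d.
have : t <= r%:R * (1 + 10 * lam ^+ 2).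
  apply: (@heavy_center_bound _ _ e Y' r m f (level e d m) d) => //.
  - by move=> u v; exact: level_edge.
  - move=> u v lu lv; apply: fP.
      by apply: (fintype.subsetP (sub_ball e d lu)); exact: mem_ball_level.
    by apply: (fintype.subsetP (sub_ball e d lv)); exact: mem_ball_level.
  - by apply/eqP; rewrite -leqn0; apply: level_le; rewrite ?inE.
  - exact: lt_le_trans cpos (dmax c).
by rewrite leNgt tbig.
Qed.

(** * Schur products of Gram matrices *)

(** Induction on the factors: a new factor adds the old form evaluated at the vectors
    [z u * X i u j], and these values are nonnegative by the induction hypothesis itself. *)
Lemma hadamard_gram (R : realType) (T : finType) (I : Type) (N : nat)
    (X : I -> T -> 'I_N -> R) (s : seq I) (z : T -> R) :
  (\sum_u z u) ^+ 2 <=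
  qform (fun u v => \prod_(i <- s) (\sum_j X i u j * X i v j + 1)) z.
Proof.
elim: s z => [|i s IH] z.
  rewrite expr2 mulr_suml /qform; apply: ler_sum => u _.
  by rewrite mulr_sumr; apply: ler_sum => v _; rewrite big_nil mul1r.
set P := fun u v => \prod_(i <- s) (\sum_j X i u j * X i v j + 1).
have -> : qform (fun u v => \prod_(i <- (i :: s)) (\sum_j X i u j * X i v j + 1)) z
    = \sum_j qform P (fun u => z u * X i u j) + qform P z.
  rewrite /qform [X in _ = X + _]exchange_big -big_split; apply: eq_bigr => u _ /=.
  rewrite [X in _ = X + _]exchange_big -big_split; apply: eq_bigr => v _ /=.
  rewrite big_cons -/(P u v) -!mulrA mulrDl mul1r; congr (_ + _).
  by rewrite mulr_suml; apply: eq_bigr => j _; ring.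
apply: le_trans (IH z) _; rewrite lerDr; apply: sumr_ge0 => j _.
exact: le_trans (sqr_ge0 _) (IH _).
Qed.

(** Off the diagonal some factor is [-1 + 1], so the product matrix is [t ^+ k] times the identity;
    testing at the all-ones vector gives [#|T| ^ 2 <= #|T| * t ^+ k]. *)
Lemma card_le_vector_colorings (R : realType) (T : finType) (k N : nat)
    (e : 'I_k -> rel T) (X : 'I_k -> T -> 'I_N -> R) (t : R) :
  (forall u v, u != v -> exists i, e i u v) ->
  (forall i u, \sum_j X i u j * X i u j = t - 1) ->
  (forall i u v, e i u v -> \sum_j X i u j * X i v j = -1) ->
  (0 < #|T|)%N -> #|T|%:R <= t ^+ k.
Proof.
move=> cover Xd Xe T0.
have := hadamard_gram X (index_enum 'I_k) (fun=> 1).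
have -> : qform (fun u v => \prod_i (\sum_j X i u j * X i v j + 1)) (fun=> 1) =
    #|T|%:R * t ^+ k.
  rewrite /qform mulr_natl -[RHS]sumr_const; apply: eq_bigr => u _.
  rewrite (bigD1 u) //= [X in _ + X]big1 ?addr0 => [|v].
    rewrite !mulr1; under eq_bigr => i _ do rewrite Xd subrK.
    by rewrite prodr_const card_ord.
  rewrite eq_sym => /cover[i euv]; rewrite (bigD1 i) //= Xe // addNr.
  by rewrite !mul0r.
by rewrite sumr_const expr2 ler_pM2l // ltr0n.
Qed.

(** * Monochromatic balls: chromatic number and diameter *)

Lemma colorable_partial (T : finType) (H : sgraph T) (r : nat) :
  (0 < r)%N -> (chromatic_number H <= r)%N ->
  exists f : T -> 'I_r, forall u v, u \in verts H -> v \in verts H ->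
    adj H u v -> f u != f v.
Proof.
rewrite /chromatic_number; case: ex_minnP => q /existsP[f0 fP] _ r0 qr.
(* Vertices outside [H] get the default color 0, which exists as [r] is positive. *)
exists (fun u => if insub u is Some u' then widen_ord qr (f0 u')
                 else Ordinal r0) => u v uH vH uv.
rewrite (insubT (fun x => x \in verts H) uH).
rewrite (insubT (fun x => x \in verts H) vH) -val_eqE /= val_eqE.
by move/forallP/(_ (Sub u uH))/forallP/(_ (Sub v vH))/implyP: fP; apply.
Qed.

(** Removing repetitions turns a walk into a path that is no longer. *)
Lemma diam_le_walk (R : realType) (T : finType) (H : sgraph T) (d : nat) :
  (forall u v, u \in verts H -> v \in verts H ->
     exists p, [/\ path (adj H) u p, last u p = v & (size p <= d)%N]) ->
  (diam R H <= d%:R%:E)%E.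
Proof.
move=> walk; apply: bigmax_le => [|u uH]; first by rewrite lee_fin.
apply: bigmax_le => [|v vH]; first by rewrite lee_fin.
have [p [pH pv pd]] := walk u v uH vH.
case/shortenP: pH pv => p' p'H p'u p'p p'v.
apply: (@le_trans _ _ (size p')%:R%:E).
  by apply: ereal_inf_lbound; exists p'.
rewrite lee_fin ler_nat; apply: leq_trans pd; apply: uniq_leq_size => //.
by case/andP: p'u.
Qed.

(** The coloring also has values on singletons, so loops are excluded explicitly. *)
Definition color_class (T : finType) (k : nat) (c : {set T} -> 'I_k)
    (i : 'I_k) : rel T := fun u v => (u != v) && (c [set u; v]%SET == i).

Lemma color_class_sym (T : finType) (k : nat) (c : {set T} -> 'I_k) (i : 'I_k) :
  symmetric (color_class c i).
Proof. by move=> u v; rewrite /color_class eq_sym finset.setUC. Qed.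

Lemma induced_edgesP (T : finType) (k : nat) (c : {set T} -> 'I_k) (i : 'I_k)
    (S : {set T}) :
  [set e in powerset S | (#|e| == 2%N) && (c e == i)]%SET \subset
  [set e in powerset S | #|e| == 2%N]%SET.
Proof.
by apply/fintype.subsetP => e; rewrite !inE => /andP[-> /andP[->]].
Qed.

Definition induced_color (T : finType) (k : nat) (c : {set T} -> 'I_k)
    (i : 'I_k) (S : {set T}) : sgraph T := SGraph (induced_edgesP c i S).

Lemma adj_induced_color (T : finType) (k : nat) (c : {set T} -> 'I_k)
    (i : 'I_k) (S : {set T}) (u v : T) :
  adj (induced_color c i S) u v =
  [&& u \in S, v \in S & color_class c i u v].
Proof.
rewrite /adj /color_class !inE cards2 finset.subUset !finset.sub1set -andbA.
by case: (u != v); rewrite ?andbF.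
Qed.

(** Walks from the center stay in smaller balls, hence in the subgraph; two of them are joined at
    the center. *)
Lemma ball_diam (R : realType) (T : finType) (k : nat) (c : {set T} -> 'I_k)
    (i : 'I_k) (x : T) (m : nat) :
  (diam R (induced_color c i (ball (color_class c i) x m)) <= (m + m)%:R%:E)%E.
Proof.
set e := color_class c i; set H := induced_color c i _.
have Hsym : symmetric (adj H).
  move=> u v; rewrite !adj_induced_color color_class_sym.
  by rewrite andbA (andbC (u \in _)) -andbA.
have radial l u : (l <= m)%N -> u \in ball e x l ->
    exists p, [/\ path (adj H) x p, last x p = u & (size p <= l)%N].
  elim: l u => [|l IH] u lm /=.
    by rewrite inE => /eqP ->; exists [::].
  rewrite !inE => /orP[ul|/existsP[w /andP[wl ewu]]].
    have [p [pH pu pl]] := IH u (ltnW lm) ul.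
    by exists p; split => //; apply: leqW.
  have [p [pH pw pl]] := IH w (ltnW lm) wl.
  exists (rcons p u); rewrite rcons_path last_rcons size_rcons pH pw; split => //.
  rewrite adj_induced_color -/e ewu andbT.
  rewrite (fintype.subsetP (sub_ball e x (ltnW lm)) _ wl).
  exact: (fintype.subsetP (sub_ball e x lm)) (ballS wl ewu).
apply: diam_le_walk => u v uB vB.
have [p [pH pu pm]] := radial m u (leqnn m) uB.
have [q [qH qv qm]] := radial m v (leqnn m) vB.
exists (rev (belast x p) ++ q).
have last_rev : last u (rev (belast x p)) = x.
  by rewrite -pu; case: (p) => //= y p'; rewrite rev_cons last_rcons.
split.
- rewrite cat_path last_rev qH andbT -pu rev_path.
  by rewrite (eq_path (e' := adj H)) // => a b; exact: Hsym.
- by rewrite last_cat last_rev.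
- by rewrite size_cat size_rev size_belast leq_add.
Qed.

(** * Numerical estimates *)

Lemma bernoulli_inv (R : realType) (x : R) (k : nat) :
  0 <= x -> (1 + x) ^+ k * (1 - k%:R * x) <= 1.
Proof.
move=> x0; elim: k => [|k IH]; first by rewrite expr0 mul0r subr0 mulr1.
apply: le_trans IH; rewrite exprSr -mulrA ler_wpM2l ?exprn_ge0 ?addr_ge0 //.
rewrite -natr1; have : 0 <= (k%:R + 1) * x ^+ 2 by rewrite mulr_ge0 ?sqr_ge0.
lra.
Qed.

Lemma pow_lt_slack (R : realType) (x delta : R) (k : nat) :
  0 <= x -> k%:R * x <= delta / 4 -> 0 < delta -> delta <= 1 ->
  (1 + x) ^+ k < 1 + delta.
Proof.
move=> x0 kx d0 d1; rewrite ltNge; apply/negP => le1.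
have := bernoulli_inv k x0; set B := (1 + x) ^+ k in le1 *.
have : (1 + delta) * (1 - delta / 4) <= B * (1 - k%:R * x).
  by apply: ler_pM => //; lra.
have : delta * delta <= delta * 1 by rewrite ler_pM2l.
lra.
Qed.

Lemma exp_decay_le (R : realType) (lam y : R) (m : nat) :
  0 <= lam <= 1 -> 0 < y -> ln y <= m%:R * lam -> (1 - lam) ^+ m <= y^-1.
Proof.
move=> /andP[l0 l1] y0 ym.
apply: (@le_trans _ _ (expR (- lam) ^+ m)).
  by apply: lerXn2r; rewrite ?nnegrE ?expR_ge0 ?expR_ge1Dx //; lra.
rewrite -expRM_natl mulrN expRN lef_pV2 ?posrE ?expR_gt0 //.
by rewrite -[leLHS]lnK ?posrE // ler_expR.
Qed.

(* The radius is of order k ln r / lam, with lam of order (delta / k) ^ (1/2):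
   the decay rate lam costs each color a factor 1 + O(lam ^+ 2), and all k
   colors together may only lose 1 + delta. *)
Lemma exists_radius (R : realType) (r k n : nat) (delta : R) :
  (2 <= r)%N -> (1 <= k)%N -> 0 < delta -> delta <= 1 ->
  n%:R = (1 + delta) * r%:R ^+ k ->
  exists lam m, [/\ 0 < lam <= 1 / 2, (1 - lam) ^+ m <= (2 * n%:R)^-1,
    k%:R * (20 * lam ^+ 2) <= delta / 4 &
    (m + m)%:R <= 58 * k%:R `^ (3 / 2) * delta `^ (- (1 / 2)) * ln r%:R].
Proof.
move=> r2 k1 d0 d1 nE.
have r2R : 2 <= r%:R :> R by rewrite ler_nat.
have k1R : 1 <= k%:R :> R by rewrite ler1n.
have rk1 : 1 <= r%:R ^+ k :> R by apply: exprn_ege1; lra.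
set a : R := Num.sqrt k%:R; set d := Num.sqrt delta; set L := ln (r%:R : R).
have a1 : 1 <= a by rewrite -sqrtr1 ler_wsqrtr.
have aa : a ^+ 2 = k%:R by rewrite sqr_sqrtr //; lra.
have dd : d ^+ 2 = delta by rewrite sqr_sqrtr // ltW.
have dpos : 0 < d by rewrite sqrtr_gt0.
have dle1 : d <= 1 by rewrite -sqrtr1 ler_wsqrtr.
have L12 : 1 / 2 <= L.
  have : ln (1 + (- (1 / 2)) : R) <= - (1 / 2) by apply: le_ln1Dx; lra.
  have -> : 1 + (- (1 / 2)) = 2^-1 :> R by lra.
  rewrite lnV ?posrE // => ln2.
  apply: (@le_trans _ _ (ln 2)); first by lra.
  by rewrite /L ler_ln ?posrE //; lra.
(* The 9 is chosen so that [20 / 81 <= 1 / 4]. *)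
set lam : R := d / (9 * a).
have lam0 : 0 < lam by apply: divr_gt0; lra.
have lam12 : lam <= 1 / 2 by rewrite /lam ler_pdivrMr; lra.
(* The 3 comes from [2 * n <= 4 * r ^ k <= r ^ (3 * k)]. *)
set Q := 3 * k%:R * L / lam.
have Q0 : 0 <= Q by rewrite /Q divr_ge0 ?(ltW lam0) // !mulr_ge0 //; lra.
set m := (Num.trunc Q).+1.
have /andP[Qm mQ] : Q <= m%:R <= Q + 1.
  have /andP[t1 t2] := truncn_itv Q0.
  by rewrite (ltW t2) /= -natr1 lerD2r.
exists lam, m; split.
- by rewrite lam0.
- apply: exp_decay_le; first by lra.
    by rewrite nE !mulr_gt0 //; lra.
  apply: (@le_trans _ _ (ln (r%:R ^+ (3 * k)))).
    rewrite ler_ln ?posrE ?exprn_gt0 ?nE ?mulr_gt0 //; try lra.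
    have r2k : 4 <= r%:R ^+ (2 * k) :> R.
      apply: (@le_trans _ _ (r%:R ^+ 2)); first by nra.
      by apply: ler_weXn2l; rewrite ?leq_pmulr //; lra.
    by rewrite mulSnr exprD; nra.
  rewrite lnXn; last by lra.
  by rewrite -[leLHS]mulr_natl natrM -/L -ler_pdivrMr.
- have -> : k%:R * (20 * lam ^+ 2) = 20 / 81 * delta.
    by rewrite -dd -aa /lam; field; rewrite gt_eqF //; lra.
  by lra.
have -> : k%:R `^ (3 / 2) = k%:R * a.
  have -> : 3 / 2 = 1 + 2^-1 :> R by lra.
  rewrite powRD; last by apply/implyP => _; rewrite gt_eqF //; lra.
  by rewrite powRr1 ?powR12_sqrt //; lra.
have -> : delta `^ (- (1 / 2)) = d^-1.
  by rewrite powRN mul1r powR12_sqrt // ltW.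
have QE : Q = 27 * (k%:R * a * d^-1 * L).
  by rewrite /Q /lam; field; rewrite !gt_eqF //; lra.
have kad : 1 <= k%:R * a * d^-1.
  rewrite -[1 in leLHS]mulr1; apply: ler_pM => //.
    by rewrite -[1 in leLHS]mulr1; apply: ler_pM.
  by rewrite -[leLHS]invr1 lef_pV2 ?posrE.
(* With [A] this product, [m + m <= 2 * Q + 2 = 54 * A + 2 <= 58 * A]. *)
have : 1 / 2 <= k%:R * a * d^-1 * L by nra.
by rewrite natrD; move: mQ; rewrite QE; lra.
Qed.

(** * Colorings of the complete graph *)

Theorem theorem1p4 (R : realType) :
  exists2 C : R, 0 < C &
    forall (r k n : nat) (delta : R),
      (2 <= r)%N -> (1 <= k)%N -> 0 < delta -> delta <= 1 ->
      n%:R = (1 + delta) * r%:R ^+ k ->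
      forall c : {set 'I_n} -> 'I_k,
        exists H : sgraph 'I_n,
          [/\ subgraph H (complete_graph n),
              monochromatic c H,
              (r + 1 <= chromatic_number H)%N &
              (diam R H <=
                 (C * (k%:R `^ (3 / 2)) * (delta `^ (- (1 / 2)))
                    * ln r%:R)%:E)%E].
Proof.
exists 58 => // r k n delta r2 k1 d0 d1 nE c.
have [lam [m [/andP[lam0 lam12] decay lamk diam_m]]] :=
  exists_radius r2 k1 d0 d1 nE.
have r0 : 0 < r%:R :> R by rewrite ltr0n ltnW.
have n0 : (0 < n)%N by rewrite -(ltr0n R) nE mulr_gt0 ?exprn_gt0 ?addr_gt0.
apply: contrapT => noH.
(* Otherwise the ball in color [i] would itself be a subgraph [H] as required. *)
have balls i x : exists f : 'I_n -> 'I_r,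
    forall u v, u \in ball (color_class c i) x m ->
      v \in ball (color_class c i) x m -> color_class c i u v -> f u != f v.
  set S := ball _ x m; set H := induced_color c i S.
  have [|f fP] := @colorable_partial _ H r (ltnW r2).
    rewrite leqNgt -addn1; apply/negP => chiH; apply: noH; exists H; split => //.
    - apply/andP; split; first exact: finset.subsetT.
      apply/fintype.subsetP => e; rewrite !inE => /andP[_ /andP[-> _]].
      by rewrite finset.subsetT.
    - by exists i => e; rewrite !inE => /andP[_ /andP[_ /eqP]].
    - by apply: (le_trans (ball_diam R c i x m)); rewrite lee_fin.
  by exists f => u v uS vS uv; apply: fP; rewrite // adj_induced_color uS vS.
(* Doubling the constant 10 gives the strict inequality that [vector_coloring] asks for. *)
pose t : R := r%:R * (1 + 20 * lam ^+ 2).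
have tbig : r%:R * (1 + 10 * lam ^+ 2) < t.
  by rewrite /t ltr_pM2l // ltrD2l ltr_pM2r ?exprn_gt0 // ltr_nat.
have vec i : exists X : 'I_n -> 'I_#|'I_n|.+1 -> R,
    (forall u, \sum_j X u j * X u j = t - 1) /\
    (forall u v, color_class c i u v -> \sum_j X u j * X v j = -1).
  apply: (vector_coloring (@color_class_sym _ k c i) _ _ _ (balls i) tbig).
  - by move=> u; rewrite /color_class eqxx.
  - by rewrite ltW.
  - by rewrite card_ord.
have [X XP] := choice vec.
have : #|'I_n|%:R <= t ^+ k.
  apply: (@card_le_vector_colorings _ _ _ _ (color_class c) X).
  - by move=> u v uv; exists (c [set u; v]%SET); rewrite /color_class uv /=.
  - by move=> i u; have [] := XP i.
  - by move=> i; have [] := XP i.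
  - by rewrite card_ord.
rewrite card_ord nE /t exprMn mulrC ler_pM2l ?exprn_gt0 //.
apply/negP; rewrite -ltNge; apply: pow_lt_slack => //.
by rewrite mulr_ge0 // ltW ?exprn_gt0.
Qed.
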